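(* Let $T$ be a tree of order $p\ge 3$. Then $\gamma_{[3R]}(T)=\frac{7p}{4}$ if and only if $T\in\mathcal{F}$.
   Context: $\mathcal{F}$ is the family of all trees obtained as follows: take $k\ge 1$ vertex-disjoint paths $P_4^i: v_1^iv_2^iv_3^iv_4^i$ ($1\le i\le k$) and add $k-1$ edges, each joining two of the vertices $v_2^1,\dots,v_2^k$, so that the subgraph induced by $\{v_2^1,\dots,v_2^k\}$ is connected. For a graph $\Gamma=(V,E)$ and $h:V\to\{0,1,2,3,4\}$, let $AN(v)=\{w\in N(v):h(w)\ge 1\}$, $AN[v]=AN(v)\cup\{v\}$ and $h(S)=\sum_{u\in S}h(u)$. $h$ is a triple Roman dominating function (3RDF) if every $v$ with $h(v)<3$ satisfies $h(AN[v])\ge|AN(v)|+3$. The triple Roman domination number $\gamma_{[3R]}(\Gamma)$ is the minimum weight $h(V)$ of a 3RDF of $\Gamma$. *)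

(* Defs.v *)
From mathcomp Require Import all_boot.
Set Implicit Arguments. Unset Strict Implicit. Unset Printing Implicit Defensive.

(* A simple graph on a finite vertex type T is a symmetric irreflexive e : rel T. *)

Definition acyclic (T : finType) (e : rel T) : Prop :=
  forall s : seq T, uniq s -> 3 <= size s -> ~~ cycle e s.

Definition is_tree (T : finType) (e : rel T) : Prop :=
  (forall x y : T, connect e x y) /\ acyclic e.

Definition AN (T : finType) (e : rel T) (h : {ffun T -> 'I_5}) (v : T) : {set T} :=
  [set w | e v w && (1 <= h w)].

Definition is3RDF (T : finType) (e : rel T) (h : {ffun T -> 'I_5}) : bool :=
  [forall v, (h v < 3) ==>
     (#|AN e h v| + 3 <= h v + \sum_(w in AN e h v) (h w : nat))].

Definition weight (T : finType) (h : {ffun T -> 'I_5}) : nat :=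
  \sum_(v : T) (h v : nat).

(* minimum weight of a 3RDF; the constant-4 function is always a 3RDF of
   weight 4 * #|T|, so the default value of the min is attained. *)
Definition gamma3R (T : finType) (e : rel T) : nat :=
  \big[minn/4 * #|T|]_(h : {ffun T -> 'I_5} | is3RDF e h) weight h.

(* Membership in the family F (up to graph isomorphism): vertices are
   v_a^i = f (i, a), i < k, a < 4 (a = 0,1,2,3 stands for subscripts 1..4);
   edges are the path edges v_a^i v_{a+1}^i plus the k-1 edges E2 between the
   vertices v_2^i (index a = 1), which induce a connected graph. *)
Definition inF (T : finType) (e : rel T) : Prop :=
  exists (k : nat) (f : 'I_k * 'I_4 -> T) (E2 : rel 'I_k),
    1 <= k /\ bijective f /\
    symmetric E2 /\ irreflexive E2 /\
    #|[set p : 'I_k * 'I_k | E2 p.1 p.2]| = 2 * (k - 1) /\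
    (forall i j : 'I_k, connect E2 i j) /\
        (forall x y : 'I_k * 'I_4,
           e (f x) (f y) =
           ((x.1 == y.1) && ((x.2.+1 == y.2 :> nat) || (y.2.+1 == x.2 :> nat)))
           || [&& (x.2 == 1 :> nat), (y.2 == 1 :> nat) & E2 x.1 y.1]).

(* Main.v *)
Require Import Defs.
From mathcomp Require Import all_boot zify.

Set Implicit Arguments. Unset Strict Implicit. Unset Printing Implicit Defensive.

(* The 3RDF condition at [v] reads [h v + \sum_(u ~ v) (h u).-1 >= 3], which can
   only become easier when edges are added; hence weights add up over any
   partition of the vertices. A connected graph with at least 3 vertices
   is partitioned, adding one vertex at a time, into spiders (a body with legs of
   length 1 and 2) with at least 3 vertices each. A spider with [n] vertices has
   a 3RDF of weight at most [7n/4], with equality only if it is a P4, so in an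
   extremal tree every partition into spiders consists of P4s only. Moving
   vertices between adjacent blocks then shows that an edge between two blocks
   joins inner vertices, and that only one inner vertex of each block has
   neighbours outside the block; that vertex is [v_2]. Conversely, in a member
   of the family each block carries weight at least 7 because of its two leaves. *)

(** * Edge count of a tree *)

Lemma cut_edge (T : finType) (e : rel T) (s : seq T) (x y : T) :
  symmetric e -> (forall x y, connect e x y) -> x \in s -> y \notin s ->
  exists u v, [/\ u \in s, v \notin s & e u v].
Proof.
move=> e_sym e_conn xs ys; have [/existsP[u /existsP[v /and3P[]]]|] :=
  boolP [exists u, exists v, [&& u \in s, v \notin s & e u v]].
  by exists u, v.
move=> noedge; have cl : closed e (mem s).
  apply: (intro_closed (sym_connect_sym e_sym)) => u v uv us.
  apply: contraNT noedge => vs.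
  by apply/existsP; exists u; apply/existsP; exists v; apply/and3P; split.
by move: ys; rewrite -(closed_connect cl (e_conn x y)) /= xs.
Qed.

Definition edges_in (T : finType) (e : rel T) (s : seq T) : {set T * T} :=
  [set p : T * T | [&& e p.1 p.2, p.1 \in s & p.2 \in s]].

(** The set grows by one boundary vertex at a time. By acyclicity the new vertex has exactly one
    neighbour in the set, so [edges_in], made of ordered pairs, gains two elements. *)
Lemma tree_prefix (T : finType) (e : rel T) (n : nat) :
  symmetric e -> irreflexive e -> is_tree e -> n < #|T| ->
  exists s : seq T, [/\ uniq s, size s = n.+1,
    {in s &, forall x y, connect [rel u v | [&& e u v, u \in s & v \in s]] x y}
    & #|edges_in e s| = 2 * n].
Proof.
move=> e_sym e_irr [e_conn e_acyc]; elim: n => [|n IHn] lt_nT.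
  have /card_gt0P[x _] : 0 < #|T| by [].
  exists [:: x]; split=> // [u v|].
    by rewrite !inE => /eqP-> /eqP->; apply: connect0.
  apply: eq_card0 => -[u v]; rewrite !inE /=; apply/and3P => -[uv /eqP ux /eqP vx].
  by rewrite ux vx e_irr in uv.
have [|s [s_uniq s_size s_conn s_edges]] := IHn; first lia.
have [x xs] : exists x, x \in s.
  by case: s s_size {s_uniq s_conn s_edges} => // x s _; exists x; rewrite mem_head.
have [y ys] : exists y, y \notin s.
  apply/existsP; apply: contraLR lt_nT => /existsPn sT.
  rewrite -leqNgt -s_size -(card_uniqP s_uniq); apply/subset_leq_card/subsetP => z _.
  by have := sT z; rewrite negbK.
have {x xs y ys} [u [v [us vs uv]]] := cut_edge e_sym e_conn xs ys.
(* A second neighbour [w] of [v] would close the simple path from [u] to [w] inside [s] into a cycle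
   through [v] of length at least 3. *)
have v_leaf w : w \in s -> e v w -> w = u.
  move=> ws vw; apply: contraTeq (vw) => w_neq_u.
  have /connectP[p0 p0_path w_last] := s_conn u w us ws.
  case: (shortenP p0_path) w_last => p p_path p_uniq _ w_last.
  have ps : {subset p <= s}.
    elim: p u us p_path {p_uniq uv w_neq_u w_last p0_path} => //=.
    move=> z p IHp u us /andP[/and3P[_ _ zs] zp] t.
    by rewrite inE => /predU1P[->|/(IHp z zs zp)].
  have p_size : 0 < size p.
    by case: p w_last w_neq_u {p_path p_uniq ps} => //= ->; rewrite eqxx.
  have c_uniq : uniq (v :: u :: p).
    rewrite cons_uniq p_uniq inE negb_or andbT; apply/andP; split.
      by apply: contraNneq vs => ->.
    by apply: contra vs; apply: ps.
  apply: contra (e_acyc _ c_uniq _) => // _.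
  rewrite /= rcons_path e_sym uv (sub_path _ p_path) => [|a b /and3P[]//].
  by rewrite e_sym -w_last vw.
exists (v :: s); split; rewrite /= ?s_size ?vs //.
  have sub : subrel (connect [rel a b | [&& e a b, a \in s & b \in s]])
              (connect [rel a b | [&& e a b, a \in v :: s & b \in v :: s]]).
    apply: connect_sub => a b /and3P[ab as_ bs]; apply: connect1.
    by rewrite /= ab !inE as_ bs !orbT.
  have vu : connect [rel a b | [&& e a b, a \in v :: s & b \in v :: s]] v u.
    by apply: connect1; rewrite /= e_sym uv mem_head inE us orbT.
  have uv' : connect [rel a b | [&& e a b, a \in v :: s & b \in v :: s]] u v.
    by apply: connect1; rewrite /= uv mem_head inE us orbT.
  move=> a b; rewrite 2!in_cons => /predU1P[->|as_] /predU1P[->|bs].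
  - exact: connect0.
  - exact: connect_trans vu (sub _ _ (s_conn _ _ us bs)).
  - exact: connect_trans (sub _ _ (s_conn _ _ as_ us)) uv'.
  - exact: sub (s_conn _ _ as_ bs).
have uNv : (u == v) = false by apply: contraNF vs => /eqP<-.
have -> : edges_in e (v :: s) = (u, v) |: ((v, u) |: edges_in e s).
  apply/setP=> -[a b]; rewrite !inE /= !xpair_eqE.
  have [->|a_neq_v] /= := eqVneq a v; have [->|b_neq_v] /= := eqVneq b v.
  - by rewrite e_irr (eq_sym v) uNv (negPf vs) !andbF.
  - rewrite (negPf vs) ?(andbF, andbT, orbF) /=; apply/andP/eqP => [[vb bs]|->].
      exact: v_leaf.
    by rewrite e_sym uv us.
  - rewrite (negPf vs) ?(andbF, andbT, orbF) /=; apply/andP/eqP => [[av as_]|->] //.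
    by apply: v_leaf; rewrite // e_sym.
  - by rewrite !andbF.
rewrite !cardsU1 s_edges !inE /= !xpair_eqE (negPf vs) !andbF /= orbF.
by rewrite uNv /=; lia.
Qed.

(** Supplies the edge count that [inF] asks of the graph on the blocks. *)
Lemma tree_edges (T : finType) (e : rel T) :
  symmetric e -> irreflexive e -> is_tree e ->
  #|[set p : T * T | e p.1 p.2]| = 2 * (#|T| - 1).
Proof.
move=> e_sym e_irr e_tree; have [T0|T_gt0] := posnP #|T|.
  by rewrite T0; apply: eq_card0 => -[u v]; case: (fintype0 u T0).
have [|s [s_uniq s_size _ s_edges]] := @tree_prefix T e #|T|.-1 e_sym e_irr e_tree; first lia.
have sT x : x \in s.
  have /subset_cardP : #|s| = #|T| by rewrite (card_uniqP s_uniq) s_size; lia.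
  by move=> /(_ (subset_predT _)) ->.
by rewrite subn1 -s_edges; apply: eq_card => p; rewrite !inE !sT !andbT.
Qed.

(** * Weights on subsets and the domination number *)

(* [s] can be defended with weight at most [w] placed on [s] alone. *)
Definition dominated (T : finType) (e : rel T) (s : seq T) (w : nat) : Prop :=
  exists h : T -> nat,
    [/\ forall v, h v <= 4, forall v, v \notin s -> h v = 0, \sum_v h v <= w
      & forall v, v \in s -> h v < 3 -> 3 <= h v + \sum_(u | e v u) (h u).-1].

(** The two labelings have disjoint supports, so their sum keeps every label and can only increase
    the neighbour sums. *)
Lemma dominated_cat (T : finType) (e : rel T) (s t : seq T) (w w' : nat) :
  uniq (s ++ t) -> dominated e s w -> dominated e t w' -> dominated e (s ++ t) (w + w').
Proof.
rewrite cat_uniq => /and3P[_ /hasPn st _] [h [h4 h0 hw hd]] [g [g4 g0 gw gd]].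
have gs v : v \in s -> g v = 0.
  by move=> vs; apply: g0; apply: contraL vs => /st.
have ht v : v \in t -> h v = 0 by move=> /st; apply: h0.
exists (fun v => h v + g v); split=> [v|v|| v].
- by have [/gs->|/h0->] := boolP (v \in s); rewrite ?addn0 ?h4 ?g4.
- by rewrite mem_cat negb_or => /andP[/h0-> /g0->].
- by rewrite big_split leq_add.
rewrite mem_cat => /orP[vs|vt].
- rewrite (gs _ vs) addn0 => /(hd _ vs)/leq_trans; apply; rewrite leq_add2l.
  by apply: leq_sum => u _; lia.
rewrite (ht _ vt) add0n => /(gd _ vt)/leq_trans; apply; rewrite leq_add2l.
by apply: leq_sum => u _; lia.
Qed.

Lemma gamma3R_le (T : finType) (e : rel T) (h : {ffun T -> 'I_5}) :
  is3RDF e h -> gamma3R e <= weight h.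
Proof.
rewrite /gamma3R => h_dom; have := mem_index_enum h.
elim: (index_enum _) => // g r IHr; rewrite inE big_cons => /predU1P[<-|/IHr {}IHr].
  by rewrite h_dom geq_minl.
by case: ifP => // _; apply: leq_trans (geq_minr _ _) IHr.
Qed.

(** The bound by [4 * #|T|] takes care of the default value of the minimum. *)
Lemma gamma3R_ge (T : finType) (e : rel T) (m : nat) :
  m <= 4 * #|T| -> (forall h, is3RDF e h -> m <= weight h) -> m <= gamma3R e.
Proof.
by move=> mT mh; rewrite /gamma3R; elim/big_ind: _ => // x y mx my; rewrite leq_min mx.
Qed.

(* Each active neighbour contributes [h w] to the left and [1] to the right of
   the defining inequality, so adding edges never destroys a 3RDF. *)
Lemma is3RDF_pred (T : finType) (e : rel T) (h : {ffun T -> 'I_5}) :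
  is3RDF e h = [forall v, (h v < 3) ==> (3 <= h v + \sum_(u | e v u) (h u).-1)].
Proof.
apply: eq_forallb => v; congr (_ ==> _).
have -> : \sum_(w in AN e h v) (h w : nat) = #|AN e h v| + \sum_(u | e v u) (h u).-1.
  rewrite -sum1_card (bigID (fun u => 0 < h u) (e v)) /=.
  rewrite [X in _ + (_ + X)]big1 ?addn0 => [|u /andP[_]]; last by case: (h u : nat).
  have -> : \sum_(u | e v u && (0 < h u)) (h u).-1 = \sum_(u in AN e h v) (h u).-1.
    by apply: eq_bigl => u; rewrite inE.
  rewrite -big_split; apply: eq_bigr => u; rewrite inE => /andP[_].
  by rewrite /=; lia.
by apply/idP/idP; lia.
Qed.

Lemma gamma3R_dominated (T : finType) (e : rel T) (s : seq T) (w : nat) :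
  (forall x, x \in s) -> dominated e s w -> gamma3R e <= w.
Proof.
move=> sT [h [h4 _ hw hd]]; pose g := [ffun v => inord (h v) : 'I_5].
have gE v : g v = h v :> nat by rewrite ffunE inordK // ltnS.
apply: leq_trans (gamma3R_le (_ : is3RDF e g)) _; last first.
  by apply: leq_trans hw; apply: leq_sum => v _; rewrite gE.
rewrite is3RDF_pred; apply/forallP => v; apply/implyP; rewrite gE => /(hd _ (sT v)).
by under eq_bigr do rewrite -gE.
Qed.

(** * Labelings of spiders *)

Lemma leq_sum_nbr (T : finType) (P : pred T) (F : T -> nat) (u : T) :
  P u -> F u <= \sum_(v | P v) F v.
Proof. by move=> Pu; rewrite (bigD1 u) //= leq_addr. Qed.

Lemma leq_sum_nbr2 (T : finType) (P : pred T) (F : T -> nat) (u v : T) :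
  P u -> P v -> u != v -> F u + F v <= \sum_(v | P v) F v.
Proof.
move=> Pu Pv uv; rewrite (bigD1 u) //= leq_add2l (bigD1 v) ?leq_addr //.
by rewrite Pv eq_sym.
Qed.

Lemma sum_mem_le (T : finType) (s : seq T) : \sum_v (v \in s : nat) <= size s.
Proof. by rewrite -big_mkcond sum1_card card_size. Qed.

(** A pair in [long_legs] lists the vertex next to the body first, then the far end. *)
Record spider (T : Type) :=
  Spider { body : T; short_legs : seq T; long_legs : seq (T * T) }.

Definition sverts (T : Type) (S : spider T) : seq T :=
  body S :: short_legs S ++ unzip1 (long_legs S) ++ unzip2 (long_legs S).

Definition spider_in (T : Type) (e : rel T) (S : spider T) : bool :=
  [&& all (e (body S)) (short_legs S),
      all (fun p => e (body S) p.1 && e p.1 p.2) (long_legs S) & 3 <= size (sverts S)].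

Definition is_P4 (T : Type) (S : spider T) : bool :=
  (size (short_legs S) == 1) && (size (long_legs S) == 1).

Lemma size_sverts (T : Type) (S : spider T) :
  size (sverts S) = 1 + size (short_legs S) + 2 * size (long_legs S).
Proof. by rewrite /= !size_cat !size_map; lia. Qed.

(** A vertex labelled 4 supplies 3 to each neighbour, which is all that a vertex labelled 0
    needs. *)
Lemma dominated_by_fours (T : finType) (e : rel T) (s D : seq T) :
  {subset D <= s} -> (forall v, v \in s -> v \in D \/ exists2 u, u \in D & e v u) ->
  dominated e s (4 * size D).
Proof.
move=> Ds D_dom; exists (fun v => 4 * (v \in D)); split=> [v|v||v vs].
- by case: (v \in D).
- by apply: contraNeq; case: (boolP (v \in D)) => // /Ds.
- by rewrite -big_distrr leq_mul2l sum_mem_le.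
case: (D_dom v vs) => [->|[u uD vu]] // _; apply: leq_trans (leq_addl _ _).
by apply: leq_trans (leq_sum_nbr _ vu); rewrite uD.
Qed.

(** The body gets 4 and supplies 3 to its neighbours; the far ends get 3 and are thereby exempt. *)
Lemma dominated_spider_body (T : finType) (e : rel T) (S : spider T) :
  symmetric e -> spider_in e S ->
  dominated e (sverts S) (4 + 3 * size (long_legs S)).
Proof.
case: S => c A B e_sym /and3P[/= /allP cA /allP cB _].
pose h v := if v == c then 4 else if v \in unzip2 B then 3 else 0.
exists h; split=> [v|v||v].
- by rewrite /h; case: ifP => // _; case: ifP.
- by rewrite /h /sverts /= !(inE, mem_cat) !negb_or => /and4P[/negPf-> _ _ /negPf->].
- apply: (@leq_trans (\sum_v (4 * (v \in [:: c]) + 3 * (v \in unzip2 B)))).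
    apply: leq_sum => v _; rewrite /h inE.
    by case: (v == c); case: (v \in unzip2 B).
  rewrite big_split /= -!big_distrr /=; apply: leq_add.
    exact: (leq_mul (leqnn 4) (sum_mem_le [:: c])).
  by rewrite leq_mul2l -(size_map snd) sum_mem_le.
have toc v0 : e v0 c -> 3 <= h v0 + \sum_(u | e v0 u) (h u).-1.
  move=> vc; apply: leq_trans (leq_addl _ _); apply: leq_trans (leq_sum_nbr _ vc).
  by rewrite /h eqxx.
rewrite /sverts /= !(inE, mem_cat) => /or4P[/eqP->|vA|/mapP[p pB ->]|vB] hv.
- by move: hv; rewrite /h eqxx.
- by apply: toc; rewrite e_sym cA.
- by apply: toc; rewrite e_sym; case/andP: (cB _ pB).
by move: hv; rewrite /h vB; case: ifP.
Qed.

(* The body and the first long leg get 2 everywhere, the other far ends get 3. *)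
Lemma dominated_spider_long (T : finType) (e : rel T) (c n f : T) (B : seq (T * T)) :
  symmetric e -> spider_in e (Spider c [::] ((n, f) :: B)) ->
  uniq (sverts (Spider c [::] ((n, f) :: B))) ->
  dominated e (sverts (Spider c [::] ((n, f) :: B))) (6 + 3 * size B).
Proof.
move=> e_sym /and3P[/= _ /andP[/andP[cn nf] /allP cB] _] s_uniq.
pose h v := if v \in [:: c; n; f] then 2 else if v \in unzip2 B then 3 else 0.
exists h; split=> [v|v||v].
- by rewrite /h; case: ifP => // _; case: ifP.
- rewrite /h /sverts /= !(inE, mem_cat) !negb_or.
  by case/and3P=> /negPf-> /negPf-> /and3P[_ /negPf-> /negPf->].
- apply: (@leq_trans (\sum_v (2 * (v \in [:: c; n; f]) + 3 * (v \in unzip2 B)))).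
    by apply: leq_sum => v _; rewrite /h; do 2 case: (v \in _).
  rewrite big_split /= -!big_distrr /=; apply: leq_add.
    exact: (leq_mul (leqnn 2) (sum_mem_le [:: c; n; f])).
  by rewrite leq_mul2l -(size_map snd) sum_mem_le.
have hc : h c = 2 by rewrite /h mem_head.
have hn : h n = 2 by rewrite /h !inE eqxx orbT.
have hf : h f = 2 by rewrite /h !inE eqxx !orbT.
(* A vertex labelled 2 lacks one unit, which a neighbour labelled 2 provides. *)
have tonbr v0 u : h v0 = 2 -> h u = 2 -> e v0 u -> 3 <= h v0 + \sum_(u | e v0 u) (h u).-1.
  by move=> -> hu vu; rewrite -addn1 leq_add2l; apply: leq_trans (leq_sum_nbr _ vu); rewrite hu.
have farN x : x \in unzip2 B -> x \notin [:: c; n; f].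
  have sub : subseq ([:: c; n; f] ++ unzip2 B) (sverts (Spider c [::] ((n, f) :: B))).
    by rewrite /= !eqxx suffix_subseq.
  by have := subseq_uniq sub s_uniq; rewrite cat_uniq => /and3P[_ /hasPn + _]; apply.
rewrite /sverts /= !(inE, mem_cat).
case/or4P => [/eqP->|/eqP->|/mapP[p pB ->]|/predU1P[->|vB]] hv.
- exact: tonbr cn.
- exact: tonbr nf.
(* The near vertex of another leg receives 1 from the body and 2 from its far end. *)
- have /andP[cp pp] := cB _ pB.
  have p2 : p.2 \in unzip2 B by apply: map_f.
  have p2N := farN _ p2.
  have c_neq : c != p.2 by apply: contraNneq p2N => <-; rewrite mem_head.
  apply: leq_trans (leq_addl _ _).
  apply: leq_trans (leq_sum_nbr2 _ _ pp c_neq); last by rewrite e_sym.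
  by rewrite hc /h (negPf p2N) p2.
- by apply: tonbr (hf) (hn) _; rewrite e_sym.
by move: hv; rewrite /h (negPf (farN _ vB)) vB.
Qed.

(** For [a] short and [b] long legs consider the slack [7 * size (sverts S) - 4 * w]. If [a >= 1],
    [dominated_spider_body] gives [7a + 2b - 9], which for at least 3 vertices vanishes only at
    [a = b = 1], the P4. If [a = 0] and [b >= 3], [dominated_spider_long] gives [2b - 5 > 0]. *)
Lemma dominated_spider (T : finType) (e : rel T) (S : spider T) :
  symmetric e -> spider_in e S -> uniq (sverts S) ->
  exists2 w, dominated e (sverts S) w & 4 * w + ~~ is_P4 S <= 7 * size (sverts S).
Proof.
move=> e_sym S_in S_uniq; have := S_in => /and3P[_ _]; rewrite size_sverts.
case: S S_in S_uniq => c [|a A] B S_in S_uniq /=; last first.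
  move=> S3; exists (4 + 3 * size B); first exact: dominated_spider_body S_in.
  rewrite /is_P4 /=; case: (ltngtP (size A) 0) => // A0; last by rewrite A0 /=; lia.
  by lia.
(* The paths on 3 and 5 vertices are too small for the labels above; 4 on each near vertex leaves
   slack 5 and 3. *)
case: B S_in S_uniq => [|[n f] [|[n' f'] [|p B]]] // S_in S_uniq _.
- exists 4 => //; apply: (@dominated_by_fours _ _ _ [:: n]).
    by move=> v; rewrite !inE => /eqP->; rewrite eqxx orbT.
  have := S_in; rewrite /spider_in /= !andbT => /andP[cn nf].
  move=> v; rewrite !inE => /or3P[]/eqP->; rewrite ?eqxx.
  + by right; exists n; rewrite ?inE.
  + by left.
  by right; exists n; rewrite ?inE // e_sym.
- exists 8 => //; apply: (@dominated_by_fours _ _ _ [:: n; n']).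
    by move=> v; rewrite !inE => /orP[]/eqP->; rewrite eqxx !orbT.
  have := S_in; rewrite /spider_in /= !andbT => /and3P[/andP[cn nf] cn' nf'].
  move=> v; rewrite !inE => /orP[/eqP->|/or4P[]/eqP->]; rewrite ?eqxx ?orbT.
  + by right; exists n; rewrite ?inE ?eqxx.
  + by left.
  + by left.
  + by right; exists n; rewrite ?inE ?eqxx // e_sym.
  by right; exists n'; rewrite ?inE ?eqxx ?orbT // e_sym.
exists (6 + 3 * size ((n', f') :: p :: B)); first exact: dominated_spider_long.
by rewrite /=; lia.
Qed.

Definition lverts (T : Type) (L : seq (spider T)) : seq T := flatten (map (@sverts T) L).

Lemma dominated_spiders (T : finType) (e : rel T) (L : seq (spider T)) :
  symmetric e -> all (spider_in e) L -> uniq (lverts L) ->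
  exists2 w, dominated e (lverts L) w
    & 4 * w + ~~ all (@is_P4 T) L <= 7 * size (lverts L).
Proof.
move=> e_sym; elim: L => [_ _|S L IHL /andP[S_in L_in]].
  by exists 0 => //; exists (fun=> 0); split=> //; rewrite big1.
rewrite -[lverts _]/(sverts S ++ lverts L) => L_uniq.
have := L_uniq; rewrite cat_uniq => /and3P[S_uniq _ L'_uniq].
have [w' domL w'_le] := IHL L_in L'_uniq.
have [w domS w_le] := dominated_spider e_sym S_in S_uniq.
exists (w + w'); first exact: dominated_cat.
by rewrite size_cat [all _ _]/=; move: w_le w'_le; case: (is_P4 S); lia.
Qed.

Lemma gamma3R_spiders (T : finType) (e : rel T) (L : seq (spider T)) :
  symmetric e -> all (spider_in e) L -> perm_eq (lverts L) (enum T) ->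
  4 * gamma3R e + ~~ all (@is_P4 T) L <= 7 * #|T|.
Proof.
move=> e_sym L_in L_enum; have L_uniq : uniq (lverts L).
  by rewrite (perm_uniq L_enum) enum_uniq.
have [w domL] := dominated_spiders e_sym L_in L_uniq.
rewrite (perm_size L_enum) -cardE; apply: leq_trans.
rewrite leq_add2r leq_mul2l; apply: gamma3R_dominated domL => x.
by rewrite (perm_mem L_enum) mem_enum.
Qed.

(** * Partition of a connected graph into spiders *)

Ltac count_lia :=
  do ?[progress rewrite /= ?count_cat];
  repeat match goal with
  | |- context [nat_of_bool ?b] => generalize (nat_of_bool b)
  | |- context [@count ?T ?p ?s] => generalize (@count T p s)
  end;
  clear; lia.

(** Lists are permutations of each other when every predicate has the same count on both; for
    explicit lists this is linear arithmetic. *)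
Ltac perm_count :=
  apply/permP => ?; rewrite /lverts /sverts /= /unzip1 /unzip2 ?map_cat ?cats0;
  count_lia.

(* If [u] lies on a long leg, that leg and [y] split off as a P3; when what
   remains has fewer than 3 vertices, the spider is re-centred instead. *)
Lemma extend_spider (T : finType) (e : rel T) (S : spider T) (u y : T) :
  symmetric e -> spider_in e S -> u \in sverts S -> e u y ->
  exists2 L, all (spider_in e) L & perm_eq (lverts L) (y :: sverts S).
Proof.
case: S => c A B e_sym /and3P[/= cA cB S3].
rewrite /sverts /= !(inE, mem_cat) => /or4P[/eqP->|uA|/mapP[[n f] pB ->]|/mapP[[n f] pB ->]] /= uy.
- exists [:: Spider c (y :: A) B]; first by rewrite /spider_in /= uy cA cB andbT; apply: ltnW.
  by perm_count.
- case/splitPr: uA cA S3 => A1 A2; rewrite all_cat /= => /and3P[cA1 cu cA2] S3.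
  exists [:: Spider c (A1 ++ A2) ((u, y) :: B)].
    rewrite /spider_in /= all_cat cA1 cA2 cu uy cB /=.
    by move: S3; rewrite !(size_cat, size_map) /= !(size_cat, size_map); lia.
  by perm_count.
- case/splitPr: pB cB S3 => B1 B2; rewrite all_cat /= => /and3P[cB1 /andP[cn nf] cB2].
  case: (leqP 3 (size (sverts (Spider c A (B1 ++ B2))))) => [R3 _|].
    exists [:: Spider c A (B1 ++ B2); Spider n [:: f; y] [::]].
      by rewrite /spider_in /= -/(sverts (Spider c A _)) all_cat cA cB1 cB2 nf uy /= andbT.
    by perm_count.
  (* A remainder of fewer than 3 vertices is the body [c] with at most one short leg [d]; the new
     body is [n]. *)
  rewrite size_sverts /= size_cat.
  case: A B1 B2 cA cB1 cB2 => [|d [|d' A]] [|q B1] [|q' B2] //=; rewrite ?(addnS, addn0, mulnS) //.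
    exists [:: Spider n [:: c; f; y] [::]]; first by rewrite /spider_in /= e_sym cn nf uy.
    by perm_count.
  rewrite andbT => cd _ _ _ _.
  exists [:: Spider n [:: f; y] [:: (c, d)]].
    by rewrite /spider_in /= nf uy (e_sym n) cn cd.
  by perm_count.
case/splitPr: pB cB S3 => B1 B2; rewrite all_cat /= => /and3P[cB1 /andP[cn nf] cB2].
case: (leqP 3 (size (sverts (Spider c A (B1 ++ B2))))) => [R3 _|].
  exists [:: Spider c A (B1 ++ B2); Spider f [:: n; y] [::]].
    by rewrite /spider_in /= -/(sverts (Spider c A _)) all_cat cA cB1 cB2 (e_sym f) nf uy /= andbT.
  by perm_count.
rewrite size_sverts /= size_cat.
case: A B1 B2 cA cB1 cB2 => [|d [|d' A]] [|q B1] [|q' B2] //=; rewrite ?(addnS, addn0, mulnS) //.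
  exists [:: Spider n [:: c] [:: (f, y)]]; first by rewrite /spider_in /= (e_sym n) cn nf uy.
  by perm_count.
rewrite andbT => cd _ _ _ _.
exists [:: Spider n [::] [:: (c, d); (f, y)]].
  by rewrite /spider_in /= nf uy (e_sym n) cn cd.
by perm_count.
Qed.

Lemma extend_spiders (T : finType) (e : rel T) (L : seq (spider T)) (u y : T) :
  symmetric e -> all (spider_in e) L -> u \in lverts L -> e u y ->
  exists2 L', all (spider_in e) L' & perm_eq (lverts L') (y :: lverts L).
Proof.
move=> e_sym L_in + uy; elim: L L_in => // S L IHL /andP[S_in L_in].
rewrite -[lverts _]/(sverts S ++ lverts L) mem_cat => /orP[uS|uL].
  have [L' L'_in L'_perm] := extend_spider e_sym S_in uS uy.
  exists (L' ++ L); first by rewrite all_cat L'_in.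
  by rewrite /lverts map_cat flatten_cat -cat_cons perm_cat2r.
have [L' L'_in L'_perm] := IHL L_in uL.
exists (S :: L'); first by rewrite /= S_in.
apply/permP => p; have /permP/(_ p) := L'_perm.
have countS x s : count p (x :: s) = p x + count p s by [].
rewrite -[lverts (S :: L')]/(sverts S ++ lverts L') !(count_cat, countS) => ->.
by rewrite addnCA.
Qed.

Lemma spider_partition_prefix (T : finType) (e : rel T) (n : nat) :
  symmetric e -> irreflexive e -> (forall x y, connect e x y) -> n.+2 < #|T| ->
  exists L, [/\ all (spider_in e) L, uniq (lverts L) & size (lverts L) = n.+3].
Proof.
move=> e_sym e_irr e_conn; have outside (s : seq T) : size s < #|T| -> exists y, y \notin s.
  move=> lt_sT; apply/existsP; apply: contraLR lt_sT => /existsPn sT.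
  rewrite -leqNgt; apply: leq_trans (card_size s); apply/subset_leq_card/subsetP => z _.
  by have := sT z; rewrite negbK.
elim: n => [|n IHn] lt_nT.
  have /card_gt0P[x _] : 0 < #|T| by lia.
  have [|y0 xy0] := outside [:: x]; first exact: ltnW.
  have [u [y [ux yx]]] := cut_edge e_sym e_conn (mem_head _ _) xy0.
  move: ux yx; rewrite !mem_seq1 => /eqP-> yx xy.
  have [|z0 xz0] := outside [:: x; y]; first by [].
  have [v [z [vxy zxy vz]]] := cut_edge e_sym e_conn (mem_head _ _) xz0.
  (* The body is the end of the edge [xy] that is adjacent to [z]; the other end becomes a leg. *)
  exists [:: Spider v [:: if v == x then y else x; z] [::]].
  move: vxy zxy; rewrite /spider_in /lverts /= !inE negb_or !andbT vz.
  case: eqVneq => [->|vx] /= => [_|/eqP->] /andP[zx zy].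
    by rewrite xy (eq_sym x y) (eq_sym x z) (eq_sym y z) (negPf yx) (negPf zx) zy.
  by rewrite e_sym xy (eq_sym x z) (eq_sym y z) (negPf yx) zx (negPf zy).
have [|L [L_in L_uniq L_size]] := IHn; first lia.
have [|y0 y0L] := outside (lverts L); first lia.
have [x0 x0L] : exists x, x \in lverts L.
  by case: (lverts L) L_size => // x s _; exists x; rewrite mem_head.
have [u [y [uL yL uy]]] := cut_edge e_sym e_conn x0L y0L.
have [L' L'_in L'_perm] := extend_spiders e_sym L_in uL uy.
exists L'; split=> //; first by rewrite (perm_uniq L'_perm) /= yL.
by rewrite (perm_size L'_perm) /= L_size.
Qed.

Lemma spider_partition (T : finType) (e : rel T) :
  symmetric e -> irreflexive e -> (forall x y, connect e x y) -> 3 <= #|T| ->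
  exists2 L, all (spider_in e) L & perm_eq (lverts L) (enum T).
Proof.
move=> e_sym e_irr e_conn T3.
have [|L [L_in L_uniq L_size]] := @spider_partition_prefix T e (#|T| - 3) e_sym e_irr e_conn.
  lia.
exists L => //; apply: uniq_perm; rewrite ?enum_uniq // => x; rewrite mem_enum inE.
have /subset_cardP : #|lverts L| = #|T| by rewrite (card_uniqP L_uniq) L_size; lia.
by move=> /(_ (subset_predT _)) ->.
Qed.

(** * Tilings by paths on four vertices *)

Definition qverts (T : Type) (A : T * T * T * T) : seq T :=
  let: (a, b, c, d) := A in [:: a; b; c; d].

Definition qpath (T : Type) (e : rel T) (A : T * T * T * T) : bool :=
  let: (a, b, c, d) := A in [&& e a b, e b c & e c d].

Definition qrev (T : Type) (A : T * T * T * T) : T * T * T * T :=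
  let: (a, b, c, d) := A in (d, c, b, a).

Definition qspider (T : Type) (A : T * T * T * T) : spider T :=
  let: (a, b, c, d) := A in Spider b [:: a] [:: (c, d)].

Definition second (T : Type) (A : T * T * T * T) : T := A.1.1.2.
Definition third (T : Type) (A : T * T * T * T) : T := A.1.2.

Definition qlverts (T : Type) (q : seq (T * T * T * T)) : seq T := flatten (map (@qverts T) q).

Definition tiling (T : finType) (e : rel T) (q : seq (T * T * T * T)) : bool :=
  all (qpath e) q && perm_eq (qlverts q) (enum T).

Lemma mem_qrev (T : eqType) (A : T * T * T * T) : qverts (qrev A) =i qverts A.
Proof. by case: A => [[[a b] c] d] x; rewrite -[RHS]mem_rev. Qed.

Lemma qpath_rev (T : finType) (e : rel T) (A : T * T * T * T) :
  symmetric e -> qpath e (qrev A) = qpath e A.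
Proof.
move=> e_sym; case: A => [[[a b] c] d] /=.
by rewrite (e_sym d c) (e_sym c b) (e_sym b a); apply/and3P/and3P => -[].
Qed.

Lemma qverts_qspiders (T : finType) (q : seq (T * T * T * T)) :
  perm_eq (lverts (map (@qspider T) q)) (qlverts q).
Proof.
elim: q => // -[[[a b] c] d] q /permP IHq; apply/permP => p.
by have := IHq p; rewrite /lverts /qlverts; count_lia.
Qed.

Lemma qspider_in (T : finType) (e : rel T) (q : seq (T * T * T * T)) :
  symmetric e -> all (qpath e) q -> all (spider_in e) (map (@qspider T) q).
Proof.
move=> e_sym; elim: q => // -[[[a b] c] d] q IHq /= /andP[/and3P[ab bc cd] /IHq->].
by rewrite /spider_in /= (e_sym b a) ab bc cd.
Qed.

Lemma P4_spiders (T : finType) (e : rel T) (L : seq (spider T)) :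
  symmetric e -> all (spider_in e) L -> all (@is_P4 T) L ->
  exists2 q, all (qpath e) q & L = map (@qspider T) q.
Proof.
move=> e_sym; elim: L => [_ _|S L IHL /andP[S_in L_in] /andP[S_P4 L_P4]]; first by exists [::].
have [q q_path ->] := IHL L_in L_P4.
case: S S_in S_P4 => b [|a [|? ?]] [|[c d] [|? ?]] //.
rewrite /spider_in /= !andbT => /and3P[ba bc cd] _.
by exists ((a, b, c, d) :: q); rewrite //= (e_sym a) ba bc cd.
Qed.

(** * Exchange arguments in an extremal tree *)

Section Extremal.
Variables (T : finType) (e : rel T).
Hypotheses (e_sym : symmetric e) (e_irr : irreflexive e) (e_tree : is_tree e).
Hypothesis e_ext : 4 * gamma3R e = 7 * #|T|.

Implicit Types (A B C : T * T * T * T) (q : seq (T * T * T * T)) (L : seq (spider T)).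

(** The tool for all exchanges: [L] rearranges some blocks and [q] holds the untouched ones.
    Equality in [e_ext] leaves no room for the extra unit due to a spider other than P4. *)
Lemma extremal_P4 L q :
  all (spider_in e) L -> all (qpath e) q -> perm_eq (lverts L ++ qlverts q) (enum T) ->
  all (@is_P4 T) L.
Proof.
move=> L_in q_path Lq_perm; have := @gamma3R_spiders T e (L ++ map (@qspider T) q) e_sym.
rewrite e_ext all_cat L_in qspider_in // => /(_ isT).
rewrite /lverts map_cat flatten_cat -!/(lverts _).
have -> : perm_eq (lverts L ++ lverts (map (@qspider T) q)) (enum T).
  by apply: perm_trans Lq_perm; rewrite perm_cat2l qverts_qspiders.
by rewrite all_cat => /(_ isT); case: (all _ L) => //=; lia.
Qed.

Lemma exists_tiling : 3 <= #|T| -> exists q, tiling e q.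
Proof.
move=> T3; have [L L_in L_perm] := spider_partition e_sym e_irr (proj1 e_tree) T3.
have L_P4 : all (@is_P4 T) L.
  by apply: (@extremal_P4 L [::]) => //; rewrite cats0.
have [q q_path defL] := P4_spiders e_sym L_in L_P4.
exists q; rewrite /tiling q_path; apply: perm_trans L_perm.
by rewrite defL perm_sym qverts_qspiders.
Qed.

Lemma tiling_split q A : tiling e q -> A \in q ->
  exists q', perm_eq q (A :: q') /\
    [/\ qpath e A, all (qpath e) q' & perm_eq (qverts A ++ qlverts q') (enum T)].
Proof.
case/andP=> q_path q_perm Aq; exists (rem A q).
have qA := perm_to_rem Aq; split=> //.
have := perm_all (qpath e) qA; rewrite q_path /= => /esym/andP[-> ->]; split=> //.
by apply: perm_trans q_perm; rewrite perm_sym; apply: (perm_flatten (perm_map _ qA)).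
Qed.

Lemma tiling_split2 q A B : tiling e q -> A \in q -> B \in q -> A != B ->
  exists q', perm_eq q [:: A, B & q'] /\
    [/\ qpath e A, qpath e B, all (qpath e) q'
      & perm_eq (qverts A ++ qverts B ++ qlverts q') (enum T)].
Proof.
move=> q_til Aq Bq AB; have [q1 [q_perm1 [A_path q1_path enum1]]] := tiling_split q_til Aq.
have Bq1 : B \in q1 by move: Bq; rewrite (perm_mem q_perm1) inE eq_sym (negPf AB).
have q1B := perm_to_rem Bq1; exists (rem B q1); split.
  by apply: perm_trans q_perm1 _; rewrite perm_cons.
have := perm_all (qpath e) q1B; rewrite q1_path /= => /esym/andP[-> ->]; split=> //.
apply: perm_trans enum1; rewrite perm_cat2l perm_sym.
exact: (perm_flatten (perm_map _ q1B)).
Qed.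

Lemma tiling_split3 q A B C : tiling e q -> A \in q -> B \in q -> C \in q ->
  A != B -> A != C -> B != C ->
  exists q', [/\ qpath e A, qpath e B, qpath e C, all (qpath e) q'
      & perm_eq (qverts A ++ qverts B ++ qverts C ++ qlverts q') (enum T)].
Proof.
move=> q_til Aq Bq Cq AB AC BC.
have [q1 [q_perm1 [A_path B_path q1_path enum1]]] := tiling_split2 q_til Aq Bq AB.
have Cq1 : C \in q1.
  by move: Cq; rewrite (perm_mem q_perm1) !inE eq_sym (negPf AC) eq_sym (negPf BC).
have q1C := perm_to_rem Cq1; exists (rem C q1).
have := perm_all (qpath e) q1C; rewrite q1_path /= => /esym/andP[-> ->]; split=> //.
apply: perm_trans enum1; rewrite !perm_cat2l perm_sym.
exact: (perm_flatten (perm_map _ q1C)).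
Qed.

(* Otherwise [a1] could join the block [B], leaving the star [a2 a3 a4]. *)
Lemma leaf_first (a1 a2 a3 a4 : T) B q (y : T) :
  qpath e (a1, a2, a3, a4) -> qpath e B -> all (qpath e) q ->
  perm_eq ([:: a1; a2; a3; a4] ++ qverts B ++ qlverts q) (enum T) ->
  y \in qverts B -> ~~ e a1 y.
Proof.
(* Reversing [B] exchanges its two halves. *)
wlog yB : B / y = B.1.1.1 \/ y = second B.
  move=> wl A_path B_path q_path Tperm yB.
  have [B1|B2] : (y = B.1.1.1 \/ y = second B) \/ (y = (qrev B).1.1.1 \/ y = second (qrev B)).
    case: B yB {B_path Tperm} => [[[b1 b2] b3] b4].
    by rewrite !inE => /or4P[]/eqP->; auto.
  - exact: (wl B).
  apply: (wl (qrev B)); rewrite ?qpath_rev ?mem_qrev //.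
  apply: perm_trans Tperm; case: B {B_path yB B2} => [[[b1 b2] b3] b4].
  by perm_count.
case: B yB => [[[b1 b2] b3] b4] yB /and3P[a12 a23 a34] /and3P[b12 b23 b34] q_path Tperm _.
(* If [y] is an end of [B], the result is a path on 5 vertices; if [y] is inner, [a1] becomes an
   additional short leg at [y]. *)
have [L2 L2_in L2_perm] : exists2 S, e a1 y -> spider_in e S
    & perm_eq (sverts S) [:: a1; b1; b2; b3; b4].
  case: yB => ->.
    exists (Spider b2 [::] [:: (b1, a1); (b3, b4)]); last by perm_count.
    by move=> /= ab; rewrite /spider_in /= (e_sym b2 b1) b12 e_sym ab b23 b34.
  exists (Spider b2 [:: b1; a1] [:: (b3, b4)]); last by perm_count.
  by move=> /= ab; rewrite /spider_in /= (e_sym b2 b1) b12 e_sym ab b23 b34.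
apply/negP => /L2_in {}L2_in.
(* The star at [a3] is no P4, so this computes to false. *)
suff : all (@is_P4 T) [:: Spider a3 [:: a2; a4] [::]; L2] by [].
apply: extremal_P4 q_path _; first by rewrite /= L2_in /spider_in /= (e_sym a3) a23 a34.
apply: perm_trans Tperm; apply/permP => p; have /permP/(_ p) := L2_perm.
by rewrite /lverts /= cats0; count_lia.
Qed.

Lemma tiling_cover q y : tiling e q -> exists2 B, B \in q & y \in qverts B.
Proof.
case/andP=> _ /perm_mem qE; apply/flatten_mapP.
by rewrite -/(qlverts q) qE mem_enum.
Qed.

(** [leaf_first] excludes both ends of [A], the last one after reversal. *)
Lemma cross_edge_inner q A x y : tiling e q -> A \in q ->
  x \in qverts A -> y \notin qverts A -> e x y -> x = second A \/ x = third A.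
Proof.
move=> q_til Aq xA yA xy; have [B Bq yB] := tiling_cover y q_til.
have AB : A != B by apply: contraNneq yA => ->.
have [q' [_ [A_path B_path q'_path Tperm]]] := tiling_split2 q_til Aq Bq AB.
case: A {Aq AB yA} xA A_path Tperm => [[[a1 a2] a3] a4].
rewrite !inE => /or4P[]/eqP x_def; rewrite x_def in xy; [|by left|by right|] => A_path Tperm.
  by have := leaf_first A_path B_path q'_path Tperm yB; rewrite xy.
have A'_path : qpath e (a4, a3, a2, a1) by rewrite -qpath_rev.
have Tperm' : perm_eq ([:: a4; a3; a2; a1] ++ qverts B ++ qlverts q') (enum T).
  by apply: perm_trans Tperm; perm_count.
by have := leaf_first A'_path B_path q'_path Tperm' yB; rewrite xy.
Qed.

(* Otherwise the two halves of [A] could join the blocks of [y] and [z]. *)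
Lemma cross_edge_both q A y z : tiling e q -> A \in q ->
  y \notin qverts A -> z \notin qverts A -> e (second A) y -> e (third A) z -> False.
Proof.
move=> q_til Aq yA zA Ay Az.
have [B Bq yB] := tiling_cover y q_til; have [C Cq zC] := tiling_cover z q_til.
have AB : A != B by apply: contraNneq yA => ->.
have AC : A != C by apply: contraNneq zA => ->.
have sA : second A \in qverts A by case: (A) => [[[? ?] ?] ?]; rewrite !inE eqxx orbT.
have tA : third A \in qverts A by case: (A) => [[[? ?] ?] ?]; rewrite !inE eqxx !orbT.
have disj D w : D \in q -> A != D -> w \in qverts A -> w \notin qverts D.
  move=> Dq AD wA; have [q' [_ [_ _ _ Tperm]]] := tiling_split2 q_til Aq Dq AD.
  have := perm_uniq Tperm; rewrite enum_uniq catA cat_uniq cat_uniq -!andbA.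
  case/and5P=> _ /hasPn + _ _ _; move=> /(_ w) nw; apply/negP => /nw.
  by rewrite /= wA.
(* Having a neighbour in [A], the vertex [w] is inner in [D]; up to reversal it is the second
   vertex, and [b2] is the other inner one. *)
have inner D w v : D \in q -> A != D -> w \in qverts D -> v \in qverts A -> e v w ->
    exists b1 b2 b3, [/\ qpath e (b1, w, b2, b3), perm_eq [:: b1; w; b2; b3] (qverts D)
      & forall t, t = second D \/ t = third D -> t = w \/ t = b2].
  move=> Dq AD wD vA vw; have [_ [_ [D_path _ _]]] := tiling_split q_til Dq.
  have := cross_edge_inner q_til Dq wD (disj _ _ Dq AD vA); rewrite e_sym => /(_ vw).
  case: D D_path {Dq AD wD} => [[[d1 d2] d3] d4] D_path [->|->].
    by exists d1, d3, d4.
  exists d4, d2, d1; rewrite -[third _]/d3; split; [by rewrite -qpath_rev|by perm_count|].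
  by move=> t [->|->]; [right|left].
have [b1 [b3 [b4 [B_path B_perm B_inner]]]] := inner B y _ Bq AB yB sA Ay.
have [c1 [c3 [c4 [C_path C_perm _]]]] := inner C z _ Cq AC zC tA Az.
have A23 : e (second A) (third A).
  have [_ [_ [+ _ _]]] := tiling_split q_til Aq.
  by case: (A) => [[[? ?] ?] ?] /and3P[].
have A_neq : second A != third A by apply: contraTneq A23 => ->; rewrite e_irr.
have outA w : w \notin qverts A -> (second A != w) && (third A != w).
  by move=> wA; apply/andP; split; apply: contraNneq wA => <-.
have [/andP[sy ty] /andP[sz tz]] := (outA _ yA, outA _ zA).
have acyc := proj2 e_tree.
(* If [y] and [z] share a block, they are equal or its two adjacent inner vertices, which gives a
   cycle of length 3 or 4. *)
have [BC|BC] := eqVneq B C.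
  have zB : z = y \/ z = b3.
    apply: B_inner; rewrite BC; apply: (cross_edge_inner q_til Cq zC (disj _ _ Cq AC tA)).
    by rewrite e_sym.
  case: zB => z_def; subst z.
    have c_uniq : uniq [:: second A; third A; y] by rewrite /= !inE !negb_or A_neq sy ty.
    by have := acyc _ c_uniq isT; rewrite /= A23 Az e_sym Ay.
  have yb3 : e y b3 by case/and3P: B_path.
  have y_neq : b3 != y by apply: contraTneq yb3 => ->; rewrite e_irr.
  have c_uniq : uniq [:: second A; third A; b3; y].
    by rewrite /= !inE !negb_or A_neq sy ty sz tz y_neq.
  by have := acyc _ c_uniq isT; rewrite /= A23 Az (e_sym b3) yb3 e_sym Ay.
have [q' [A_path _ _ q'_path Tperm]] := tiling_split3 q_til Aq Bq Cq AB AC BC.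
case: A {Aq yA zA AB AC sA tA disj inner A23 A_neq outA sy ty sz tz} A_path Tperm Ay Az
  => [[[a1 a2] a3] a4].
rewrite /second /third /= => /and3P[a12 a23 a34] Tperm ay az.
case/and3P: B_path => b12 b23 b34; case/and3P: C_path => c12 c23 c34.
(* Each half of [A] becomes a second long leg, giving two spiders on 6 vertices. *)
suff : all (@is_P4 T) [:: Spider y [:: b1] [:: (b3, b4); (a2, a1)];
                          Spider z [:: c1] [:: (c3, c4); (a3, a4)]] by [].
apply: extremal_P4 q'_path _.
  rewrite /spider_in /= (e_sym y b1) (e_sym z c1) (e_sym y a2) (e_sym z a3) (e_sym a2 a1).
  by rewrite b12 b23 b34 c12 c23 c34 ay az a12 a34.
apply: perm_trans Tperm; apply/permP => p.
have /permP/(_ p) := B_perm; have /permP/(_ p) := C_perm.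
by rewrite /lverts /= ?cats0; count_lia.
Qed.

(* Makes the inner vertex with outside neighbours, if any, the second one. *)
Definition orient A : T * T * T * T :=
  if [exists y, (y \notin qverts A) && e (third A) y] then qrev A else A.

Lemma mem_orient A : qverts (orient A) =i qverts A.
Proof. by rewrite /orient; case: ifP => // _; apply: mem_qrev. Qed.

Lemma tiling_orient q : tiling e q -> tiling e (map orient q).
Proof.
case/andP=> q_path q_perm; apply/andP; split.
  rewrite all_map; apply: sub_all q_path => A /=; rewrite /orient.
  by case: ifP => //; rewrite qpath_rev.
apply: perm_trans q_perm; elim: q {q_path} => // A q IHq.
rewrite -[qlverts (map _ _)]/(qverts (orient A) ++ qlverts (map orient q)).
rewrite -[qlverts (_ :: _)]/(qverts A ++ qlverts q); apply: perm_cat => //.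
by rewrite /orient; case: ifP => // _; case: A => [[[a b] c] d]; perm_count.
Qed.

(** If the third vertex has an outside neighbour, [cross_edge_both] denies one to the second, and
    [orient] swaps the two. *)
Lemma orient_cross q A x y : tiling e q -> A \in map orient q ->
  x \in qverts A -> y \notin qverts A -> e x y -> x = second A.
Proof.
move=> q_til /mapP[B Bq ->]; rewrite !mem_orient => xB yB xy.
have xE := cross_edge_inner q_til Bq xB yB xy; rewrite /orient.
case: ifP => [/existsP[z /andP[zB Bz]]|/existsPn noz].
  case: xE => x_def; last by case: (B) x_def => [[[? ?] ?] ?].
  by case: (@cross_edge_both q B y z); rewrite // -x_def.
by case: xE => // x_def; have := noz y; rewrite yB -x_def xy.
Qed.

(** * An extremal tree belongs to the family *)

Lemma extremal_inF : 3 <= #|T| -> inF e.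
Proof.
move=> T3; have [q0 q0_til] := exists_tiling T3.
have q_til := tiling_orient q0_til.
have q_cross := fun A x y => @orient_cross q0 A x y q0_til.
move: (map orient q0) q_til q_cross => q {q0 q0_til} q_til q_cross.
have /andP[q_path q_perm] := q_til.
have /card_gt0P[x0 _] : 0 < #|T| by lia.
pose A0 := (x0, x0, x0, x0); pose k := size q.
pose Q (i : 'I_k) := nth A0 q i.
have Qq i : Q i \in q by apply: mem_nth.
pose f (p : 'I_k * 'I_4) := nth x0 (qverts (Q p.1)) p.2.
have size_q A : size (qverts A) = 4 by case: A => [[[? ?] ?] ?].
have fQ i a : f (i, a) \in qverts (Q i) by apply: mem_nth; rewrite size_q.
have f_surj y : y \in codom f.
  have [B Bq yB] := tiling_cover y q_til.
  have iP : index B q < k by rewrite index_mem.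
  have aP : index y (qverts B) < 4 by rewrite -(size_q B) index_mem.
  apply/codomP; exists (Ordinal iP, Ordinal aP).
  by rewrite /f /Q /= !nth_index.
have card_k : #|T| = 4 * k.
  rewrite cardE -(perm_size q_perm) /k /qlverts.
  by elim: (q) => //= A q' IHq; rewrite size_cat size_q IHq; lia.
(* A surjection between finite sets of equal size is injective. *)
have f_inj : injective f.
  have /image_injP : #|image f predT| == #|{: 'I_k * 'I_4}|.
    rewrite card_prod !card_ord mulnC -card_k; apply/eqP; apply: eq_card => y.
    by rewrite f_surj.
  by move=> inj u v; apply: inj.
have f_bij : bijective f.
  by apply: inj_card_bij => //; rewrite card_prod !card_ord card_k mulnC.
have fQ_eq i j a : f (i, a) \in qverts (Q j) -> i = j.
  move=> /(nthP x0)[b]; rewrite size_q => b4 fE.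
  by have /f_inj[] : f (j, Ordinal b4) = f (i, a).
have second_f i : f (i, inord 1) = second (Q i).
  by rewrite /f /= inordK //; case: (Q i) => [[[? ?] ?] ?].
pose E2 : rel 'I_k := fun i j => e (second (Q i)) (second (Q j)).
have E2_sym : symmetric E2 by move=> i j; apply: e_sym.
have E2_irr : irreflexive E2 by move=> i; apply: e_irr.
have cross i j a b : i != j -> e (f (i, a)) (f (j, b)) ->
    f (i, a) = second (Q i).
  move=> ij fe; apply: q_cross (Qq i) (fQ _ _) _ fe.
  by apply: contra ij => /fQ_eq->.
have second_inj : injective (fun i => second (Q i)).
  by move=> i j; rewrite -!second_f => /f_inj[].
have E2_conn i j : connect E2 i j.
  have /connectP[p] := proj1 e_tree (second (Q i)) (second (Q j)).
  (* Positions inside the blocks are generalised, since a path may visit any vertex of a block; each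
     change of block is an [E2] edge. *)
  rewrite -2!second_f; move: (inord 1) {2}(inord 1) => a b.
  elim: p i a => [|y p IHp] i a /=; first by move=> _ /f_inj[-> _]; apply: connect0.
  have /codomP[[l c] ->] := f_surj y; case/andP=> fe /IHp {}IHp /IHp.
  have [->//|il] := eqVneq i l; apply: connect_trans; apply: connect1.
  rewrite /E2 -(cross _ _ _ _ il fe) -(cross l i c a) //; first by rewrite eq_sym.
  by rewrite e_sym.
(* An [E2] cycle lifts to an [e] cycle through the second vertices. *)
have E2_tree : is_tree E2.
  split=> // s s_uniq s3; have := proj2 e_tree (map (fun i => second (Q i)) s).
  by rewrite map_inj_uniq // size_map cycle_map; apply.
exists k, f, E2; do !split=> //; first by lia.
  by rewrite (tree_edges E2_sym E2_irr E2_tree) card_ord.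
move=> [i a] [j b] /=; have [<-|ij] /= := eqVneq i j; last first.
  apply/idP/and3P => [fe|[a1 b1]].
    have fa := cross _ _ _ _ ij fe.
    have fb : f (j, b) = second (Q j) by apply: (cross j i b a); rewrite 1?eq_sym 1?e_sym.
    rewrite /E2 -fa -fb; split=> //.
      by move: fa; rewrite -second_f => /f_inj[->]; rewrite inordK.
    by move: fb; rewrite -second_f => /f_inj[->]; rewrite inordK.
  rewrite /E2 -!second_f; congr (e (f (_, _)) (f (_, _))); apply/val_inj.
    by rewrite /= inordK //; apply/esym/eqP.
  by rewrite /= inordK //; apply/esym/eqP.
rewrite E2_irr !andbF orbF.
have [q1 [_ [Q_path _ Q_perm]]] := tiling_split q_til (Qq i).
have : uniq (qverts (Q i)).
  by have := perm_uniq Q_perm; rewrite enum_uniq cat_uniq => /and3P[].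
rewrite /f /= {Q_perm}; case: (Q i) Q_path => [[[a1 a2] a3] a4] /and3P[a12 a23 a34] A_uniq.
(* A chord of the block would close a cycle of length 3 or 4. *)
have a13 : e a1 a3 = false.
  apply: contraNF (proj2 e_tree [:: a1; a2; a3] _ isT); last exact: (take_uniq 3 A_uniq).
  by rewrite /= a12 a23 e_sym => ->.
have a24 : e a2 a4 = false.
  apply: contraNF (proj2 e_tree [:: a2; a3; a4] _ isT); last exact: (drop_uniq 1 A_uniq).
  by rewrite /= a23 a34 e_sym => ->.
have a14 : e a1 a4 = false.
  apply: contraNF (proj2 e_tree [:: a1; a2; a3; a4] A_uniq isT).
  by rewrite /= a12 a23 a34 e_sym => ->.
case: a => -[|[|[|[|//]]]] ? /=; case: b => -[|[|[|[|//]]]] ? /=;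
  by rewrite ?e_irr // e_sym.
Qed.

End Extremal.

(** * Lower bound for members of the family *)

(* The leaves [v1] and [v4] force weight at least 3 on each half of the block,
   with equality only for (3,0); both halves being tight would leave [v3] undefended. *)
Lemma inF_weight_ge (T : finType) (e : rel T) (h : {ffun T -> 'I_5}) :
  inF e -> is3RDF e h -> 7 * #|T| <= 4 * weight h.
Proof.
case=> k [f [E2 [_ [f_bij [_ [_ [_ [_ eE]]]]]]]]; rewrite is3RDF_pred => /forallP h_dom.
have -> : #|T| = 4 * k by rewrite -(bij_eq_card f_bij) card_prod !card_ord mulnC.
suff : 7 * k <= weight h by lia.
rewrite /weight (reindex f) /=; last exact: onW_bij.
have <- : \sum_(i < k) \sum_(a < 4) (h (f (i, a)) : nat) = \sum_p (h (f p) : nat).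
  by rewrite pair_bigA; apply: eq_bigr => -[].
rewrite mulnC -[X in X * 7]card_ord -sum_nat_const; apply: leq_sum => i _.
have f_inj := bij_inj f_bij.
pose v a (a4 : a < 4) := f (i, Ordinal a4).
(* Only [v_2], of index 1, can have neighbours in other blocks. *)
have nbr a (a4 : a < 4) p : a != 1 -> e (v a a4) (f p) =
    (i == p.1) && ((a.+1 == p.2) || (p.2.+1 == a :> nat)).
  by move=> a1; rewrite eE /= (negPf a1) orbF.
have f_eq p a (a4 : a < 4) : (f p == v a a4) = (i == p.1) && (a == p.2).
  by rewrite (inj_eq f_inj); case: p => j b; rewrite xpair_eqE eq_sym -val_eqE (eq_sym a).
pose H a (a4 : a < 4) := h (v a a4) : nat.
have -> : \sum_(a < 4) (h (f (i, a)) : nat) = H 0 isT + H 1 isT + H 2 isT + H 3 isT.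
  rewrite !big_ord_recl big_ord0 addn0 !addnA.
  by do !congr addn; congr (nat_of_ord (h (f (i, _)))); apply: val_inj.
have [g fK gK] := f_bij.
have sum1 a (a4 : a < 4) b (b4 : b < 4) : a != 1 ->
    (forall c, c < 4 -> (a.+1 == c) || (c.+1 == a) = (b == c)) ->
    \sum_(u | e (v a a4) u) (h u).-1 = (H b b4).-1.
  move=> a1 ab; apply: big_pred1 => u; rewrite -(gK u) nbr // ab //.
  by rewrite -f_eq.
have d0 := implyP (h_dom (v 0 isT)); have d3 := implyP (h_dom (v 3 isT)).
have d2 := implyP (h_dom (v 2 isT)).
move: d0 d3 d2; rewrite (sum1 0 isT 1 isT) //; last by case=> [|[|[|[|]]]].
rewrite (sum1 3 isT 2 isT) //; last by case=> [|[|[|[|]]]].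
have -> : \sum_(u | e (v 2 isT) u) (h u).-1 = (H 1 isT).-1 + (H 3 isT).-1.
  rewrite (bigD1 (v 1 isT)) /=; last by rewrite nbr // !eqxx.
  congr addn; apply: big_pred1 => u; rewrite -(gK u) /= nbr // !f_eq.
  case: (i == _) => //=; rewrite ?andbF //.
  by case: (g u).2 => -[|[|[|[|]]]].
rewrite -!/(H _ _); move: (H 0 isT) (H 1 isT) (H 2 isT) (H 3 isT); clear; lia.
Qed.

Theorem theorem14 (T : finType) (e : rel T) :
  symmetric e -> irreflexive e -> is_tree e -> 3 <= #|T| ->
  (4 * gamma3R e = 7 * #|T| <-> inF e).
Proof.
move=> e_sym e_irr e_tree T3; split=> [e_ext|eF]; first exact: extremal_inF.
apply/eqP; rewrite eqn_leq; apply/andP; split.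
  (* The upper bound holds for every tree on at least 3 vertices. *)
  have [L L_in L_perm] := spider_partition e_sym e_irr (proj1 e_tree) T3.
  by apply: leq_trans (gamma3R_spiders e_sym L_in L_perm); apply: leq_addr.
have [k [f [_ [_ [f_bij _]]]]] := eF.
have Tk : #|T| = 4 * k by rewrite -(bij_eq_card f_bij) card_prod !card_ord mulnC.
suff : 7 * k <= gamma3R e by lia.
(* The side condition reads [7 * k <= 4 * (4 * k)]. *)
apply: gamma3R_ge; first by lia.
by move=> h h_dom; have := inF_weight_ge eF h_dom; lia.
Qed.
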